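(* For every irrational number $\alpha\in(0,1)$ one has 1) $\displaystyle \limsup_{t\to\infty}\frac{I_\alpha(t)}{N(\alpha,t)}\le 1$, and 2) $\displaystyle \liminf_{t\to\infty}\frac{I_\alpha(t)}{N(\alpha,t)}\ge \frac12-\frac{\sqrt5}{10}$.
   Context: For a real irrational number $\alpha$ and real $t\ge 1$ put $\psi_\alpha(t)=\min_{1\le q\le t}\|q\alpha\|$, where $q$ runs over integers and $\|\cdot\|$ denotes the distance to the nearest integer, and $I_\alpha(t)=\int_1^t\psi_\alpha(\xi)\,d\xi$. Let $\alpha=[a_0;a_1,a_2,\ldots]$ be the regular continued fraction expansion of $\alpha$ and $p_\nu/q_\nu=[a_0;a_1,\ldots,a_\nu]$ ($\nu\ge 0$, in lowest terms, $q_\nu>0$, so $q_0=1$) its convergents. For $t>1$ the integer $N=N(\alpha,t)$ is defined by the condition $q_N\le t<q_{N+1}$. *)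

(* Defs.v *)
From mathcomp Require Import all_boot all_order all_algebra.
From mathcomp Require Import all_classical all_reals all_analysis.

Set Implicit Arguments.
Unset Strict Implicit.
Unset Printing Implicit Defensive.

Import Order.TTheory GRing.Theory Num.Theory.
Import numFieldNormedType.Exports.

Local Open Scope classical_set_scope.
Local Open Scope ring_scope.

(* The distance ||x|| from x to the nearest integer, which is either the floor
   or the ceiling of x. *)
Definition dist_int {R : realType} (x : R) : R :=
  Num.min (x - (Num.floor x)%:~R) ((Num.ceil x)%:~R - x).

Lemma dist_intP (R : realType) (x : R) :
  (forall m : int, dist_int x <= `|x - m%:~R|) /\
  exists m : int, dist_int x = `|x - m%:~R|.
Proof.
have fx : (Num.floor x)%:~R <= x by exact: Num.Theory.floor_le.
have cx : x <= (Num.ceil x)%:~R by exact: Num.Theory.ceil_ge.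
split=> [m|]; last first.
  rewrite /dist_int /Num.min; case: ifP => _.
    by exists (Num.floor x); rewrite ger0_norm ?subr_ge0.
  by exists (Num.ceil x); rewrite distrC ger0_norm ?subr_ge0.
rewrite /dist_int ge_min; case: (leP m%:~R x) => [mx|/ltW xm].
  by rewrite ger0_norm ?subr_ge0// lerD2l lerN2 ler_int floor_ge_int mx.
by rewrite distrC ger0_norm ?subr_ge0// lerD2r ler_int ceil_le_int xm orbT.
Qed.

(* For t >= 1 the index q runs over the integers 1 <= q <= t; the default value
   of the iterated minimum is the term q = 1, so it does not alter the minimum
   (see [psiP]). For t < 1 the value is irrelevant. *)
Definition psi {R : realType} (alpha t : R) : R :=
  \big[Num.min/dist_int alpha]_(1 <= q < (Num.truncn t).+1)
    dist_int (q%:R * alpha).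

Lemma psiP (R : realType) (alpha t : R) : 1 <= t ->
  (forall q : nat, (1 <= q)%N -> q%:R <= t ->
     psi alpha t <= dist_int (q%:R * alpha)) /\
  exists q : nat, [/\ (1 <= q)%N, q%:R <= t &
     psi alpha t = dist_int (q%:R * alpha)].
Proof.
move=> t1; have t0 : 0 <= t by exact: le_trans t1.
split=> [q q1 qt|].
  rewrite /psi; apply: ge_bigmin_seq => //.
  by rewrite mem_index_iota q1 ltnS truncn_ge_nat.
rewrite /psi big_nat.
elim/big_ind: _ => [|x y [p [p1 pt ->]] [q [q1 qt ->]]|q /andP[q1 qt]].
- by exists 1%N; rewrite mul1r.
- by rewrite /Num.min; case: ifP => _; [exists p|exists q].
- by exists q; rewrite q1 -truncn_ge_nat.
Qed.

Definition int_psi {R : realType} (alpha t : R) : R :=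
  \int[lebesgue_measure]_(xi in `[1, t]) psi alpha xi.

(* Complete quotients of alpha: the n-th partial quotient is the floor of the
   n-th complete quotient (none of them is an integer if alpha is irrational). *)
Fixpoint complete_quotient {R : realType} (alpha : R) (n : nat) : R :=
  if n is n'.+1 then
    let x := complete_quotient alpha n' in (x - (Num.floor x)%:~R)^-1
  else alpha.

Definition partial_quotient {R : realType} (alpha : R) (n : nat) : int :=
  Num.floor (complete_quotient alpha n).

(* The finite continued fraction [a; s_0, s_1, ...]. *)
Fixpoint contfrac (a : int) (s : seq int) : rat :=
  if s is b :: s' then a%:~R + (contfrac b s')^-1 else a%:~R.

Definition convergent {R : realType} (alpha : R) (n : nat) : rat :=
  contfrac (partial_quotient alpha 0)
           [seq partial_quotient alpha i | i <- iota 1 n].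

(* [denq] is the positive denominator in lowest terms. *)
Definition conv_den {R : realType} (alpha : R) (n : nat) : int :=
  denq (convergent alpha n).

(* The N such that q_N <= t < q_(N+1); for alpha irrational and t >= 1 it exists
   and is unique, the default value 0 of [xget] being used only otherwise. *)
Definition conv_index {R : realType} (alpha t : R) : nat :=
  xget 0%N [set n : nat |
    (conv_den alpha n)%:~R <= t < (conv_den alpha n.+1)%:~R].

(* Main.v *)
Require Import Defs.
From mathcomp Require Import all_boot all_order all_algebra.
From mathcomp Require Import all_classical all_reals all_analysis.
From mathcomp Require Import measurable_realfun.
From mathcomp Require Import ring lra zify.

Import Order.TTheory GRing.Theory Num.Theory.
Import numFieldNormedType.Exports.

Local Open Scope classical_set_scope.
Local Open Scope ring_scope.

(** Let [p_n / q_n] be the convergents of [alpha] and put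
    [xi_n = |q_n alpha - p_n|].  Since convergents are best approximations,
    [psi alpha] is constantly [xi_n] on [[q_n, q_(n+1))] ([psi_conv]), so that
    up to a last incomplete term, which lies between 0 and 1, the integral is
    the sum over [n < N] of [f_n = xi_n (q_(n+1) - q_n)].

    The identity [q_(n+1) xi_n + q_n xi_(n+1) = 1] ([den_approx_err]) gives
    [f_n <= 1], whence [I <= N + 1] and the first claim.

    For the second claim a single [f_n] may be arbitrarily small, so only the
    average is bounded below.  With [a = a_(n+1)], [Theta_n = q_n xi_n] and
    [C_n = q_(n-1) xi_n], the same identity yields
      [2 f_n = 1 + (a - 2) Theta_n + C_n - C_(n+1)],
    where the [C_n] telescope.  Moreover [1 / Theta_n = a + r + y] with
    [r = q_(n-1) / q_n] and [y = xi_(n+1) / xi_n] ([den_mul_approx_err]), and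
    the neighbouring values of these ratios are [1 / (a + r)], one index
    further, and [1 / (a + y)], one index before.  So it suffices to find a
    bounded function [G] with
      [(2 - a) / (a + r + y)
         <= 1 / sqrt 5 + (G r - G (1 / (a + r)) + G y - G (1 / (a + y))) / 2]
    for all integers [a >= 1] and all [r], [y] in [[0, 1]]
    ([theta_potential_le]): summing over [n] then gives
    [I >= (1/2 - 1/(2 sqrt 5)) N - 1] because everything involving [G]
    telescopes, and [1/(2 sqrt 5) = sqrt 5 / 10].

    Only [a = 1] makes the left-hand side positive.  There the convexity of the
    inverse separates the variables,
      [1 / (1 + r + y) <= (1 / (1 + 2 r) + 1 / (1 + 2 y)) / 2],
    with equality on the diagonal, and one is left with the inequality
    [1 / (1 + 2 x) <= 1 / sqrt 5 + G x - G (1 / (1 + x))], which is an equality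
    at the fixed point [g = (sqrt 5 - 1) / 2] of [x |-> 1 / (1 + x)].  A
    quadratic polynomial [G] does the job ([potential]). *)

(** * A potential for the map x |-> 1 / (a + x) *)

Section Potential.
Context {R : realFieldType}.
Variable g : R.
Hypotheses (g0 : 0 < g) (gE : g ^+ 2 = 1 - g).

(** The slope at [g] is forced: [1 / (1 + 2 x)] has slope [- 2/5] at [g] while
    [G x - G (1 / (1 + x))] has slope [G' g * (1 + g ^+ 2)] there, and
    [(6 + 2 g) / 25 = 2 / (5 (1 + g ^+ 2))].  The coefficient [4/3] has to be
    large enough to dominate the second-order term of [1 / (1 + 2 x)] for all
    [x >= 0] and small enough for the cases [a >= 2]. *)
Definition potential (x : R) : R :=
  - (6 + 2 * g) / 25 * (x - g) + 4 / 3 * (x - g) ^+ 2.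

Lemma golden_bounds : 618 / 1000 <= g <= 619 / 1000.
Proof.
apply/andP; split; rewrite leNgt; apply/negP => h.
  have : g * g < 618 / 1000 * g by rewrite ltr_pM2r.
  by rewrite -expr2 gE; lra.
have : 619 / 1000 * g < g * g by rewrite ltr_pM2r.
by rewrite -expr2 gE; lra.
Qed.

(** Both sides agree to first order at [g], so their difference is divisible by
    [(r - g) ^+ 2]; as [(1 + r)^-1] and [(1 + 2 r)^-1] are at most [1], the
    cofactor is at least [4/3 g - 4/5 > 0].  Here [(2 g + 1) / 5] is
    [1 / sqrt 5]. *)
Lemma potential_step1 (r : R) : 0 <= r ->
  (1 + 2 * r)^-1 <= (2 * g + 1) / 5 + potential r - potential (1 + r)^-1.
Proof.
move=> r0; have /andP[gl gu] := golden_bounds.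
rewrite -subr_ge0.
have -> :
  (2 * g + 1) / 5 + potential r - potential (1 + r)^-1 - (1 + 2 * r)^-1 =
  (r - g) ^+ 2 * ((6 + 2 * g) / 25 * (1 - g) * (1 + r)^-1 +
    4 / 3 * (1 - (1 - g) * (1 + r)^-1 ^+ 2) - 4 / 5 * (1 + 2 * r)^-1).
  rewrite /potential; field: gE.
  by apply/andP; split; lra.
rewrite mulr_ge0 ?sqr_ge0//.
have i0 : 0 <= (1 + r)^-1 by rewrite invr_ge0; lra.
have i1 : (1 + r)^-1 <= 1 by rewrite invf_le1; lra.
have j1 : (1 + 2 * r)^-1 <= 1 by rewrite invf_le1; lra.
have i2 : (1 + r)^-1 ^+ 2 <= 1 by rewrite expr_le1.
nra.
Qed.

Lemma potential_ge x : - (1 / 50) <= potential x.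
Proof.
have /andP[gl gu] := golden_bounds.
have -> : potential x =
    4 / 3 * (x - g - 3 * (3 + g) / 100) ^+ 2 - 3 / 2500 * (3 + g) ^+ 2.
  by rewrite /potential; field.
have : 0 <= (x - g - 3 * (3 + g) / 100) ^+ 2 by exact: sqr_ge0.
have -> : (3 + g) ^+ 2 = 10 + 5 * g by ring: gE.
lra.
Qed.

Lemma potential_le x : 0 <= x <= 1 -> potential x <= 7 / 10.
Proof.
move=> /andP[x0 x1]; have /andP[gl gu] := golden_bounds.
rewrite /potential; nra.
Qed.

Lemma potential_le_quarter x : 1 / 4 <= x <= 1 -> potential x <= 3 / 10.
Proof.
move=> /andP[x0 x1]; have /andP[gl gu] := golden_bounds.
rewrite /potential; nra.
Qed.

Lemma inv_mean_le (x y : R) : 0 <= x -> 0 <= y ->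
  (1 + x + y)^-1 <= ((1 + 2 * x)^-1 + (1 + 2 * y)^-1) / 2.
Proof.
move=> x0 y0; rewrite -subr_ge0.
have -> : ((1 + 2 * x)^-1 + (1 + 2 * y)^-1) / 2 - (1 + x + y)^-1 =
  (x - y) ^+ 2 / ((1 + 2 * x) * (1 + 2 * y) * (1 + x + y)).
  by field; apply/and3P; split; lra.
by rewrite divr_ge0 ?sqr_ge0// !mulr_ge0//; lra.
Qed.

(** For [a >= 2] the left-hand side is nonpositive and crude bounds on the
    potential are enough: if [a <= 3], then [(a + x)^-1] stays above [1/4],
    where the potential is small; if [a >= 4], the left-hand side is at most
    [- 1/3]. *)
Lemma theta_potential_le (a : nat) (r y : R) :
  (0 < a)%N -> 0 <= r <= 1 -> 0 <= y <= 1 ->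
  (2 - a%:R) / (a%:R + r + y) <= (2 * g + 1) / 5 +
    (potential r - potential (a%:R + r)^-1
     + potential y - potential (a%:R + y)^-1) / 2.
Proof.
move=> a0 /andP[r0 r1] /andP[y0 y1]; have /andP[gl gu] := golden_bounds.
case: a a0 => [//|[_|a _]].
  have h1 := potential_step1 r r0; have h2 := potential_step1 y y0.
  have h3 := inv_mean_le r y r0 y0.
  have -> : 2 - 1%:R = 1 :> R by ring.
  rewrite mul1r; lra.
have pr := potential_ge r; have py := potential_ge y.
have [a2|a2] := leqP 2 a; last first.
  have a1 : a.+2%:R <= 3 :> R by rewrite ler_nat.
  have a3 : 2 <= a.+2%:R :> R by rewrite ler_nat.
  have h z : 0 <= z <= 1 -> potential (a.+2%:R + z)^-1 <= 3 / 10.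
    move=> /andP[z0 z1]; apply: potential_le_quarter; apply/andP; split.
      rewrite mul1r lef_pV2 ?posrE; lra.
    rewrite invf_le1; lra.
  have h1 := h r; have h2 := h y.
  have : (2 - a.+2%:R) / (a.+2%:R + r + y) <= 0.
    by rewrite mulr_le0_ge0 ?invr_ge0; lra.
  rewrite r0 r1 y0 y1 in h1 h2; lra.
have a4 : 4 <= a.+2%:R :> R by rewrite ler_nat.
have h z : 0 <= z <= 1 -> potential (a.+2%:R + z)^-1 <= 7 / 10.
  move=> /andP[z0 z1]; apply: potential_le; rewrite invr_ge0 invf_le1; lra.
have h1 := h r; have h2 := h y.
have : (2 - a.+2%:R) / (a.+2%:R + r + y) <= - (1 / 3).
  rewrite ler_pdivrMr; lra.
rewrite r0 r1 y0 y1 in h1 h2; lra.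
Qed.

End Potential.

(** * Numerators and denominators of a continued fraction *)

(** The three-term recurrence solved by the numerators and denominators of the
    convergents.  The index is shifted by one: with the initial values below,
    [cf_num a n.+1] and [cf_den a n.+1] are the usual [p_n] and [q_n], and
    index [0] stands for [p_(-1) = 1] and [q_(-1) = 0]. *)
Fixpoint cf_rec (a : nat -> int) (u v : int) (n : nat) : int :=
  match n with
  | 0 => u
  | n'.+1 => if n' is n''.+1 then a n' * cf_rec a u v n' + cf_rec a u v n''
             else v
  end.

Definition cf_num (a : nat -> int) := cf_rec a 1 (a 0).
Definition cf_den (a : nat -> int) := cf_rec a 0 1.

Lemma cf_recSS a u v n :
  cf_rec a u v n.+2 = a n.+1 * cf_rec a u v n.+1 + cf_rec a u v n.
Proof. by []. Qed.

(** [contfrac] recurses on the first partial quotient whereas [cf_rec] extends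
    the sequence at its end; this is the recurrence in the other direction. *)
Lemma cf_rec_shift (a : nat -> int) n :
  cf_den a n.+1 = cf_num (a \o succn) n /\
  cf_num a n.+1 = a 0 * cf_num (a \o succn) n + cf_den (a \o succn) n.
Proof.
pose b := a \o succn; pose shift k :=
  cf_den a k.+1 = cf_num b k /\ cf_num a k.+1 = a 0 * cf_num b k + cf_den b k.
suff [] : shift n /\ shift n.+1 by [].
rewrite /shift /cf_den /cf_num.
elim: n => [|n [[d0 n0] [d1 n1]]]; first by rewrite /=; split; split; ring.
split; first by split.
split; rewrite cf_recSS [in RHS]cf_recSS.
  by rewrite d1 d0.
by rewrite n1 n0 [cf_rec b 0 1 n.+2]cf_recSS /=; ring.
Qed.

Lemma cf_den_ge0 a n :
  (forall i, 0 < a i.+1) -> 0 <= cf_den a n /\ 0 < cf_den a n.+1.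
Proof.
move=> a0; elim: n => [//|n [h0 h1]]; split; first exact: ltW.
rewrite /cf_den cf_recSS -/(cf_den a n.+1) -/(cf_den a n).
by rewrite ltr_wpDr// mulr_gt0.
Qed.

Lemma cf_den_gt0 a n : (forall i, 0 < a i.+1) -> 0 < cf_den a n.+1.
Proof. by move=> /(@cf_den_ge0 a n)[]. Qed.

Lemma cf_den_leS a n : (forall i, 0 < a i.+1) -> cf_den a n <= cf_den a n.+1.
Proof.
move=> a0; case: n => [//|n].
rewrite /cf_den cf_recSS -/(cf_den a n.+1) -/(cf_den a n).
have [d0 d1] := @cf_den_ge0 a n a0.
have : 1 * cf_den a n.+1 <= a n.+1 * cf_den a n.+1.
  by rewrite ler_pM2r// -gtz0_ge1.
lia.
Qed.

Lemma cf_den_ge a n : (forall i, 0 < a i.+1) -> n%:Z <= cf_den a n.+1.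
Proof.
move=> a0; elim: n => [//|[|n] IH]; first exact: cf_den_gt0.
rewrite /cf_den cf_recSS -/(cf_den a n.+2) -/(cf_den a n.+1).
have d1 := @cf_den_gt0 a n a0; have d2 := @cf_den_gt0 a n.+1 a0.
have : 1 * cf_den a n.+2 <= a n.+2 * cf_den a n.+2.
  by rewrite ler_pM2r// -gtz0_ge1.
lia.
Qed.

Lemma cf_det a n :
  cf_num a n.+1 * cf_den a n - cf_num a n * cf_den a n.+1 = (-1) ^+ n.+1.
Proof.
rewrite /cf_num /cf_den; elim: n => [|n IH]; first by rewrite /=; ring.
by rewrite exprS -IH !cf_recSS; ring.
Qed.

Lemma contfracE a n : (forall i, 0 < a i.+1) ->
  contfrac (a 0) [seq a i | i <- iota 1 n] =
  (cf_num a n.+1)%:~R / (cf_den a n.+1)%:~R.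
Proof.
elim: n a => [|n IH] a a0; first by rewrite /= divr1.
have [-> ->] := cf_rec_shift a n.+1.
rewrite [iota 1 n.+1]/= [map _ _]/= [contfrac _ _]/=.
rewrite -(addn1 1%N) iotaDl -map_comp (eq_map (g := a \o succn)); last first.
  by move=> i; rewrite /= addnC addn1.
rewrite -[a 1]/((a \o succn) 0) IH//; last by move=> i; exact: a0.
have n0 : (cf_num (a \o succn) n.+1)%:~R != 0 :> rat.
  have [<- _] := cf_rec_shift a n.+1.
  by rewrite intr_eq0 gt_eqF// cf_den_gt0.
by rewrite invf_div intrD intrM mulrDl mulfK.
Qed.

(** The determinant is a Bezout relation, so the fraction is in lowest terms. *)
Lemma denq_contfrac a n : (forall i, 0 < a i.+1) ->
  denq (contfrac (a 0) [seq a i | i <- iota 1 n]) = cf_den a n.+1.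
Proof.
move=> a0; have d0 := @cf_den_gt0 a n a0.
rewrite contfracE// coprimeq_den; first by rewrite gt_eqF// gtr0_norm.
rewrite -coprimezE; apply/coprimezP.
exists ((-1) ^+ n.+1 * cf_den a n, - ((-1) ^+ n.+1 * cf_num a n)) => /=.
apply: etrans (sqrr_sign int n.+1); rewrite expr2 -[X in _ = _ * X](cf_det a n).
by rewrite /=; ring.
Qed.

(** * Convergents of an irrational number *)

Definition cq_frac {R : realType} (alpha : R) n : R :=
  complete_quotient alpha n - (partial_quotient alpha n)%:~R.

(** The approximation error [|q_(n-1) alpha - p_(n-1)|], in the index convention
    of [cf_num] and [cf_den] (see [approx_errE]).  As a product its sign and
    the ratio of consecutive errors are immediate. *)
Definition approx_err {R : realType} (alpha : R) n : R :=
  \prod_(i < n) cq_frac alpha i.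

Section Convergents.
Context {R : realType} {alpha : R}.
Hypothesis irr_alpha : @irrational R alpha.

Local Notation x := (complete_quotient alpha).
Local Notation a := (partial_quotient alpha).
Local Notation y := (cq_frac alpha).
Local Notation e := (approx_err alpha).
Local Notation P := (cf_num a).
Local Notation Q := (cf_den a).

Lemma complete_quotientS n : x n.+1 = (y n)^-1.
Proof. by []. Qed.

Lemma irrational_complete_quotient n : @irrational R (x n).
Proof.
elim: n => [//|n IH]; rewrite complete_quotientS => -[r _ rE]; apply: IH.
exists (r^-1 + (a n)%:~R) => //.
by rewrite rmorphD /= fmorphV /= rE invrK ratr_int /cq_frac subrK.
Qed.

Lemma cq_frac_gt0 n : 0 < y n.
Proof.
rewrite lt_neqAle eq_sym subr_ge0 /partial_quotient Num.Theory.floor_le andbT.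
apply/eqP => h; apply: (irrational_complete_quotient n).
exists (a n)%:~R => //; rewrite ratr_int; apply/esym/eqP.
by rewrite -subr_eq0; apply/eqP.
Qed.

Lemma cq_frac_lt1 n : y n < 1.
Proof.
rewrite /cq_frac ltrBlDr addrC.
by have := floorD1_gt (x n); rewrite intrD.
Qed.

Lemma cq_fracV n : (y n)^-1 = (a n.+1)%:~R + y n.+1.
Proof. by rewrite -complete_quotientS /cq_frac addrC subrK. Qed.

Lemma partial_quotient_gt0 n : 0 < a n.+1.
Proof.
rewrite gtz0_ge1 /partial_quotient floor_ge_int complete_quotientS.
by rewrite invf_ge1 ?cq_frac_gt0// ltW// cq_frac_lt1.
Qed.

Lemma cf_den_gt0R n : 0 < (Q n.+1)%:~R :> R.
Proof. by rewrite ltr0z cf_den_gt0//; exact: partial_quotient_gt0. Qed.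

Lemma cf_den_ge0R n : 0 <= (Q n)%:~R :> R.
Proof. by rewrite ler0z; case: (@cf_den_ge0 a n partial_quotient_gt0). Qed.

Lemma cf_den_leR n : (Q n)%:~R <= (Q n.+1)%:~R :> R.
Proof. by rewrite ler_int cf_den_leS//; exact: partial_quotient_gt0. Qed.

Lemma cf_denSSR n : (Q n.+2)%:~R = (a n.+1)%:~R * (Q n.+1)%:~R + (Q n)%:~R :> R.
Proof. by rewrite -intrM -intrD. Qed.

Lemma conv_denE n : conv_den alpha n = Q n.+1.
Proof.
by rewrite /conv_den /convergent denq_contfrac//; exact: partial_quotient_gt0.
Qed.

Lemma approx_err_gt0 n : 0 < e n.
Proof. by rewrite prodr_gt0// => i _; exact: cq_frac_gt0. Qed.

Lemma approx_errS n : e n.+1 = e n * y n.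
Proof. by rewrite /approx_err big_ord_recr. Qed.

Lemma approx_errSS n : e n.+2 = e n - (a n.+1)%:~R * e n.+1.
Proof.
have y0 : y n != 0 by rewrite gt_eqF// cq_frac_gt0.
have -> : e n = e n.+1 * (y n)^-1 by rewrite approx_errS mulfK.
by rewrite cq_fracV [e n.+2]approx_errS; ring.
Qed.

Lemma den_approx_err n : (Q n.+1)%:~R * e n + (Q n)%:~R * e n.+1 = 1.
Proof.
elim: n => [|n IH]; first by rewrite /approx_err big_ord0 mul0r addr0 mul1r.
rewrite cf_denSSR approx_errSS -[RHS]IH; ring.
Qed.

Lemma approx_errE n : (Q n)%:~R * alpha - (P n)%:~R = (-1) ^+ n.+1 * e n.
Proof.
suff [] : (Q n)%:~R * alpha - (P n)%:~R = (-1) ^+ n.+1 * e n /\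
  (Q n.+1)%:~R * alpha - (P n.+1)%:~R = (-1) ^+ n.+2 * e n.+1 by [].
elim: n => [|n [h0 h1]].
  rewrite /approx_err big_ord0 big_ord1 /cq_frac /cf_num /=; split; ring.
split=> //; rewrite cf_denSSR approx_errSS.
have -> : (P n.+2)%:~R = (a n.+1)%:~R * (P n.+1)%:~R + (P n)%:~R :> R.
  by rewrite -intrM -intrD.
rewrite !exprS in h0 h1 *.
rewrite (_ : _ - _ = (a n.+1)%:~R * ((Q n.+1)%:~R * alpha - (P n.+1)%:~R) +
 ((Q n)%:~R * alpha - (P n)%:~R)); last by ring.
rewrite h0 h1; ring.
Qed.

(** Consecutive convergents form a basis of the integer lattice, so [(q, p)] is
    [u] times one plus [v] times the next, with integers [u] and [v].  As
    [0 < q < q_(n+1)], the coefficient [u] is nonzero and [v] does not have the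
    same sign as [u]; since the errors of consecutive convergents alternate in
    sign, the two contributions to [q alpha - p] add up. *)
Lemma best_approx n (q p : int) : 0 < q -> q < Q n.+2 ->
  e n.+1 <= `|q%:~R * alpha - p%:~R|.
Proof.
move=> q0 qQ.
pose s : int := (-1) ^+ n.+2.
have ss : s * s = 1 by rewrite -expr2 sqrr_sign.
pose u := s * (P n.+2 * q - Q n.+2 * p).
pose v := s * (Q n.+1 * p - P n.+1 * q).
have det : P n.+2 * Q n.+1 - P n.+1 * Q n.+2 = s by exact: cf_det.
have qE : q = u * Q n.+1 + v * Q n.+2.
  transitivity (s * s * q); first by rewrite ss mul1r.
  by rewrite -{2}det /u /v; ring.
have pE : p = u * P n.+1 + v * P n.+2.
  transitivity (s * s * p); first by rewrite ss mul1r.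
  by rewrite -{2}det /u /v; ring.
have -> : `|q%:~R * alpha - p%:~R| = `|u%:~R * e n.+1 - v%:~R * e n.+2|.
  have -> : q%:~R * alpha - p%:~R =
      (-1) ^+ n.+2 * (u%:~R * e n.+1 - v%:~R * e n.+2).
    have h1 := approx_errE n.+1; have h2 := approx_errE n.+2.
    rewrite qE pE 2!intrD 4!intrM.
    transitivity (u%:~R * ((Q n.+1)%:~R * alpha - (P n.+1)%:~R) +
      v%:~R * ((Q n.+2)%:~R * alpha - (P n.+2)%:~R)); first by ring.
    by rewrite h1 h2 [(-1) ^+ n.+3]exprS; ring.
  by rewrite normrM normrX normrN1 expr1n mul1r.
have Q1 := @cf_den_gt0 a n partial_quotient_gt0.
have Q2 := @cf_den_gt0 a n.+1 partial_quotient_gt0.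
have e1 := approx_err_gt0 n.+1; have e2 := approx_err_gt0 n.+2.
have [[u1 v1]|[u1 v1]] : (1 <= u /\ v <= 0) \/ (u <= -1 /\ 0 <= v).
  case: (ltgtP v 0) => v0.
  - by left; split; [nia|lia].
  - by right; split; [nia|lia].
  - by left; split; [nia|lia].
- have uR : 1 <= u%:~R :> R by rewrite ler1z.
  have vR : v%:~R <= 0 :> R by rewrite lerz0.
  by apply: le_trans (ler_norm _); nra.
- have uR : u%:~R <= -1 :> R by rewrite -(intrN _ 1) ler_int.
  have vR : 0 <= v%:~R :> R by rewrite ler0z.
  by rewrite -normrN; apply: le_trans (ler_norm _); nra.
Qed.

Lemma psi_conv n (t : R) :
  (Q n.+1)%:~R <= t -> t < (Q n.+2)%:~R -> psi alpha t = e n.+1.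
Proof.
move=> Qt tQ; have Q1 := @cf_den_gt0 a n partial_quotient_gt0.
have t1 : 1 <= t by apply: le_trans Qt; rewrite ler1z -gtz0_ge1.
have [psi_le [q [q1 qt psiE]]] := psiP alpha t1.
apply/eqP; rewrite eq_le; apply/andP; split.
  have QE : (absz (Q n.+1))%:R = (Q n.+1)%:~R :> R.
    by rewrite natr_absz gtr0_norm.
  apply: le_trans (psi_le (absz (Q n.+1)) _ _) _; rewrite ?QE//.
    by rewrite absz_gt0 gt_eqF.
  have [+ _] := dist_intP ((Q n.+1)%:~R * alpha).
  move=> /(_ (P n.+1)) /le_trans; apply.
  rewrite approx_errE normrM normrX normrN1 expr1n mul1r gtr0_norm//.
  exact: approx_err_gt0.
rewrite psiE; have [_ [m ->]] := dist_intP (q%:R * alpha).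
rewrite -[q%:R]/(q%:~R); apply: best_approx; first by rewrite ltz_nat.
by rewrite -(ltr_int R); apply: le_lt_trans tQ.
Qed.

(** * The integral up to a denominator *)

Lemma dist_int_ge0 (z : R) : 0 <= dist_int z.
Proof. by have [_ [m ->]] := dist_intP z. Qed.

Lemma psi_nonincreasing : nonincreasing_fun (psi alpha).
Proof. by move=> s t st; apply: le_bigmin_nat => //; rewrite ltnS le_truncn. Qed.

Lemma psi_ge0 t : 0 <= psi alpha t.
Proof. by apply: le_bigmin => [|i _]; exact: dist_int_ge0. Qed.

Lemma integrable_psi (s t : R) :
  (@lebesgue_measure R).-integrable `[s, t] (EFin \o psi alpha).
Proof.
apply: measurable_bounded_integrable => //.
- rewrite /= lebesgue_measure_itv/=; case: ifP => _; last by rewrite ltry.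
  by rewrite -EFinB ltry.
- by apply: nonincreasing_measurable => //; exact: psi_nonincreasing.
- exists (dist_int alpha); split; first exact: num_real.
  move=> z /ltW distz u _ /=; apply: le_trans distz.
  by rewrite ger0_norm ?psi_ge0//; exact: bigmin_le_id.
Qed.

(** The right endpoint, where [psi alpha] may already have dropped to the next
    value, has measure zero. *)
Lemma int_psi_step n (t : R) : (Q n.+1)%:~R <= t -> t <= (Q n.+2)%:~R ->
  int_psi alpha t = int_psi alpha (Q n.+1)%:~R + e n.+1 * (t - (Q n.+1)%:~R).
Proof.
set s : R := (Q n.+1)%:~R => st tQ.
have s1 : 1 <= s.
  by rewrite /s ler1z -gtz0_ge1 cf_den_gt0//; exact: partial_quotient_gt0.
apply/eqP; rewrite addrC -subr_eq; apply/eqP.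
rewrite /int_psi Rintegral_itvB ?bnd_simp//; last exact: integrable_psi.
rewrite -Rintegral_itv_bndo_bndc; last first.
  apply: integrableS (integrable_psi s t) => //.
  by apply: subset_itv; rewrite bnd_simp.
rewrite (@eq_Rintegral _ _ _ _ _ (fun=> e n.+1)).
  rewrite Rintegral_cst//= lebesgue_measure_itv/= lte_fin.
  case: ltP => [_|ts]; first by rewrite -EFinB.
  have -> : t = s by apply/eqP; rewrite eq_le st ts.
  by rewrite subrr mulr0.
move=> u; rewrite inE/= in_itv/= => /andP[su ut].
by apply: psi_conv; [exact: ltW | exact: lt_le_trans tQ].
Qed.

Lemma int_psi1 : int_psi alpha 1 = 0.
Proof. by rewrite /int_psi set_itv1 Rintegral_set1. Qed.

(** Each step contributes [e (Q' - Q)] with [0 <= e Q' <= 1]. *)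
Lemma int_psi_den n : 0 <= int_psi alpha (Q n.+1)%:~R <= n%:R.
Proof.
elim: n => [|n /andP[IH0 IH]]; first by rewrite int_psi1 lexx.
have := cf_den_leR n.+1 => QQ.
rewrite (int_psi_step n)//.
have := den_approx_err n.+1; have := cf_den_gt0R n; have := cf_den_gt0R n.+1.
have := approx_err_gt0 n.+1; have := approx_err_gt0 n.+2.
rewrite -[n.+1]addn1 natrD addn1; nra.
Qed.

(** * The average of the terms *)

Definition den_ratio n : R := (Q n)%:~R / (Q n.+1)%:~R.

Lemma den_ratio_itv n : 0 <= den_ratio n <= 1.
Proof.
have Q1 := cf_den_gt0R n; rewrite /den_ratio.
by rewrite divr_ge0 ?cf_den_ge0R ?(ltW Q1)//= ler_pdivrMr// mul1r cf_den_leR.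
Qed.

Lemma den_ratioS n : den_ratio n.+1 = ((a n.+1)%:~R + den_ratio n)^-1.
Proof.
have Q1 := cf_den_gt0R n.
by rewrite /den_ratio cf_denSSR -invf_div mulrDl mulfK ?gt_eqF.
Qed.

(** Divide [den_approx_err] by [Theta = q_n xi_n]. *)
Lemma den_mul_approx_err n : (Q n.+1)%:~R * e n.+1 =
  ((a n.+1)%:~R + den_ratio n + y n.+1)^-1.
Proof.
have Q1 := cf_den_gt0R n; have e1 := approx_err_gt0 n.+1.
apply/esym/mulr1_eq.
have := den_approx_err n.+1; rewrite cf_denSSR (approx_errS n.+1); apply: etrans.
by rewrite /den_ratio; field; rewrite gt_eqF.
Qed.

(** For [g = (sqrt 5 - 1) / 2] the factor of [n] is [1/2 - sqrt 5 / 10]. *)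
Lemma int_psi_den_ge (g : R) n : 0 < g -> g ^+ 2 = 1 - g ->
  (1 - (2 * g + 1) / 5) / 2 * n%:R - 1 <= int_psi alpha (Q n.+1)%:~R.
Proof.
move=> g0 gE.
(* Everything that telescopes: the products C_k and the potentials. *)
pose Phi k := (Q k)%:~R * e k.+1 +
  (potential g (y k) - potential g (den_ratio k)) / 2.
have step k : (1 - (2 * g + 1) / 5) + Phi k - Phi k.+1 <=
   2 * (e k.+1 * ((Q k.+2)%:~R - (Q k.+1)%:~R)).
  have a0 := partial_quotient_gt0 k.
  have aE : (absz (a k.+1))%:R = (a k.+1)%:~R :> R.
    by rewrite natr_absz gtr0_norm.
  have y01 : 0 <= y k.+1 <= 1 by rewrite !ltW ?cq_frac_gt0 ?cq_frac_lt1.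
  have := theta_potential_le g g0 gE (absz (a k.+1)) _ _ _ (den_ratio_itv k) y01.
  rewrite absz_gt0 gt_eqF// aE -den_mul_approx_err -den_ratioS -cq_fracV invrK.
  move=> /(_ isT).
  have := den_approx_err k.+1; rewrite /Phi cf_denSSR.
  lra.
have : (1 - (2 * g + 1) / 5) * n%:R + Phi 0%N - Phi n <=
    2 * int_psi alpha (Q n.+1)%:~R.
  elim: n => [|n IH]; first by rewrite int_psi1; lra.
  rewrite (@int_psi_step n) ?cf_den_leR//.
  by have := step n; rewrite -[n.+1]addn1 natrD addn1; lra.
have b k : - (1 / 2) <= (potential g (y k) - potential g (den_ratio k)) / 2 <= 1 / 2.
  have y01 : 0 <= y k <= 1 by rewrite !ltW ?cq_frac_gt0 ?cq_frac_lt1.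
  have h1 := potential_ge g g0 gE (y k).
  have h2 := potential_ge g g0 gE (den_ratio k).
  have := potential_le g g0 gE _ y01.
  have := potential_le g g0 gE _ (den_ratio_itv k).
  lra.
have /andP[b0 _] := b 0%N; have /andP[_ bn] := b n.
have c0 : Phi 0%N >= - (1/2) by rewrite /Phi mul0r add0r.
have cn : (Q n)%:~R * e n.+1 <= 1.
  rewrite -[leRHS](den_approx_err n) lerDr.
  by rewrite mulr_ge0 ?cf_den_ge0R ?(ltW (approx_err_gt0 _)).
rewrite /Phi in c0 *; lra.
Qed.

Lemma conv_index_spec (t : R) : 1 <= t ->
  (Q (conv_index alpha t).+1)%:~R <= t < (Q (conv_index alpha t).+2)%:~R.
Proof.
move=> t1.
suff : exists n, [set n : nat |
    (conv_den alpha n)%:~R <= t < (conv_den alpha n.+1)%:~R] n.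
  by move=> /(xgetPex 0%N) /=; rewrite !conv_denE.
have ex : exists n, t < (Q n.+2)%:~R.
  exists (Num.bound t); have t0 : 0 <= t by lra.
  have := archi_boundP t0 => /lt_le_trans; apply.
  rewrite -[X in X <= _]/((Posz _)%:~R) ler_int.
  apply: le_trans (@cf_den_ge a _ partial_quotient_gt0) _.
  by apply: cf_den_leS; exact: partial_quotient_gt0.
case: (ex_minnP ex) => n tQ nmin.
exists n => /=; rewrite !conv_denE tQ andbT.
case: n tQ nmin => [//|n] tQ nmin.
by rewrite leNgt; apply/negP => /nmin; rewrite ltnn.
Qed.

Lemma conv_index_cvg M : \forall t \near +oo, (M <= conv_index alpha t)%N.
Proof.
near=> t.
have t1 : 1 <= t by near: t; exact: nbhs_pinfty_ge.
have tQ : (Q M.+1)%:~R <= t by near: t; apply: nbhs_pinfty_ge; exact: num_real.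
have /andP[_ tN] := conv_index_spec _ t1.
rewrite leqNgt; apply/negP => NM.
have mono : {homo (fun k => (Q k)%:~R : R) : m k / (m <= k)%N >-> m <= k}.
  by apply: homo_leq => [//|p q r|k]; [exact: le_trans|exact: cf_den_leR].
have := mono (conv_index alpha t).+2 M.+1 NM.
by rewrite leNgt (le_lt_trans tQ tN).
Unshelve. all: by end_near.
Qed.

Lemma int_psi_bounds (g t : R) : 0 < g -> g ^+ 2 = 1 - g -> 1 <= t ->
  (1 - (2 * g + 1) / 5) / 2 * (conv_index alpha t)%:R - 1 <= int_psi alpha t
    <= (conv_index alpha t)%:R + 1.
Proof.
move=> g0 gE t1; have /andP[Qt tQ] := conv_index_spec _ t1.
set N := conv_index alpha t in Qt tQ *.
rewrite (int_psi_step _ _ Qt (ltW tQ)).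
have lo := int_psi_den_ge g N g0 gE; have /andP[_ up] := int_psi_den N.
have e1 := approx_err_gt0 N.+1; have e2 := approx_err_gt0 N.+2.
have Q1 := cf_den_gt0R N.
have := den_approx_err N.+1.
have p : 0 <= e N.+1 * (t - (Q N.+1)%:~R) by rewrite mulr_ge0 ?subr_ge0// ltW.
have := ltW tQ; nra.
Qed.

End Convergents.

(** * The theorem *)

Lemma limf_esup_le (T : choiceType) (X : filteredType T) (R : realType)
    (F : set_system X) (f : X -> R) (c : R) :
  (forall eps, 0 < eps -> \forall t \near F, f t <= c + eps) ->
  (limf_esup (fun t => (f t)%:E) F <= c%:E)%E.
Proof.
move=> f_le; apply/lee_addgt0Pr => eps /f_le Feps.
rewrite limf_esupE; apply: ereal_inf_le; eexists.
  by exists [set t | f t <= c + eps].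
by apply: ge_ereal_sup => _ [t t_le <-]; rewrite -EFinD lee_fin.
Qed.

Lemma limf_einf_ge (T : choiceType) (X : filteredType T) (R : realType)
    (F : set_system X) {FF : Filter F} (f : X -> R) (c : R) :
  (forall eps, 0 < eps -> \forall t \near F, c - eps <= f t) ->
  (c%:E <= limf_einf (fun t => (f t)%:E) F)%E.
Proof.
move=> f_ge; rewrite /limf_einf -leeN2 oppeK.
apply: (@limf_esup_le _ _ _ _ (fun t => - f t) (- c)) => eps /f_ge.
by apply: filterS => t; lra.
Qed.

Theorem theorem2 (R : realType) (alpha : R) (irr_alpha : @irrational R alpha)
    (alpha_gt0 : 0 < alpha) (alpha_lt1 : alpha < 1) :
  (limf_esup (fun t : R => (int_psi alpha t / (conv_index alpha t)%:R)%:E) +oo%R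
     <= 1%:E)%E /\
  ((1 / 2 - Num.sqrt 5 / 10)%:E
     <= limf_einf (fun t : R => (int_psi alpha t / (conv_index alpha t)%:R)%:E)
          +oo%R)%E.
Proof.
pose g : R := (Num.sqrt 5 - 1) / 2.
have s5 : Num.sqrt 5 ^+ 2 = 5 :> R by rewrite sqr_sqrtr.
have g0 : 0 < g.
  have : 1 < Num.sqrt 5 :> R by rewrite -[ltLHS]sqrtr1 ltr_sqrt; lra.
  by rewrite /g; lra.
have gE : g ^+ 2 = 1 - g by rewrite /g; field: s5.
have cE : (1 - (2 * g + 1) / 5) / 2 = 1 / 2 - Num.sqrt 5 / 10 by rewrite /g; field.
(* [N] tends to infinity, so the additive constants are negligible. *)
have N_large (eps : R) : 0 < eps -> \forall t \near +oo,
    [/\ 1 <= t, 0 < (conv_index alpha t)%:R :> R &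
        1 <= eps * (conv_index alpha t)%:R].
  move=> eps0; near=> t; split.
  - by near: t; exact: nbhs_pinfty_ge.
  - rewrite ltr0n; near: t; exact: conv_index_cvg.
  - rewrite mulrC -ler_pdivrMr// mul1r.
    apply: (@le_trans _ _ (Num.bound eps^-1)%:R).
      by rewrite ltW// archi_boundP// invr_ge0 ltW.
    rewrite ler_nat; near: t; exact: conv_index_cvg.
split.
  apply: limf_esup_le => eps /N_large; apply: filterS => t [t1 N0 Neps].
  have /andP[_ up] := int_psi_bounds irr_alpha g t g0 gE t1.
  by rewrite ler_pdivrMr//; lra.
apply: limf_einf_ge => eps /N_large; apply: filterS => t [t1 N0 Neps].
have /andP[lo _] := int_psi_bounds irr_alpha g t g0 gE t1.
by rewrite ler_pdivlMr// -cE; lra.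
Unshelve. all: by end_near.
Qed.
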